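(* Assume the network graph is connected and that $\sum_{k=1}^N R_{u,k}$ is positive-definite (the individual $R_{u,k}$ being positive-semidefinite and possibly singular). Then there exists $\bar\eta$ such that for every $\eta>\bar\eta$ the matrix $\mathcal{B}'=I_{(2N-1)M}-\mu\mathcal{R}'$ is stable for small $\mu$; that is, for every $\eta>\bar\eta$ there is $\bar\mu>0$ (depending on $\eta$) such that $\rho(\mathcal{B}')<1$ for all $0<\mu<\bar\mu$, where $\rho$ denotes the spectral radius.
   Context: Graph: $G$ is an undirected graph with nodes $1,\dots,N$ and $E$ edges (self-loops excluded). Its incidence matrix $C\in\mathbb{R}^{E\times N}$ has, in the row of edge $e$, entry $+1$ at the lower-indexed endpoint, $-1$ at the higher-indexed endpoint, and $0$ elsewhere. The Laplacian is $L=C^{T}C$. When $G$ is connected, $C$ has rank $N-1$. Fix a singular value decomposition $C=USV^{T}$ with $U\in\mathbb{R}^{E\times E}$, $V\in\mathbb{R}^{N\times N}$ orthogonal, $V=[\,V_2\ \ \tfrac{1}{\sqrt N}\mathbf 1_N]$, and $S\in\mathbb{R}^{E\times N}$ whose upper-left $(N-1)\times(N-1)$ block $S_2$ is diagonal with the nonzero singular values of $C$, all other entries of $S$ being zero. Put $\mathcal{S}_2=S_2\otimes I_M$, $\mathcal{V}_2=V_2\otimes I_M$, $\mathcal{V}_0=\tfrac{1}{\sqrt N}\mathbf 1_N\otimes I_M$. Data: for each agent $k=1,\dots,N$, $R_{u,k}\in\mathbb{R}^{M\times M}$ is a symmetric positive-semidefinite (regressor covariance) matrix, and $\mathcal{H}=\mathrm{blockdiag}\{R_{u,1},\dots,R_{u,N}\}$.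 The parameter $\eta\ge 0$ is the regularization parameter (the case $\eta=0$ is the Arrow-Hurwicz algorithm, $\eta>0$ the augmented Lagrangian algorithm) and $\mu>0$ is the step-size. The mean-error recursion of the algorithm is governed by $\mathcal{B}'=I_{(2N-1)M}-\mu\mathcal{R}'$, where $$\mathcal{R}'=\begin{bmatrix}\mathcal{V}_2^{T}\mathcal{H}\mathcal{V}_2+\eta\,\mathcal{S}_2^{T}\mathcal{S}_2 & \mathcal{V}_2^{T}\mathcal{H}\mathcal{V}_0 & \mathcal{S}_2^{T}\\ \mathcal{V}_0^{T}\mathcal{H}\mathcal{V}_2 & \frac1N\sum_{k=1}^N R_{u,k} & 0\\ -\mathcal{S}_2 & 0 & 0\end{bmatrix}\in\mathbb{R}^{(2N-1)M\times(2N-1)M}.$$ *)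

(* Defs.v *)
From HB Require Import structures.
From mathcomp Require Import all_boot all_order all_algebra.
From mathcomp Require Import complex mxtens.
From mathcomp Require Import boolp classical_sets reals.

Set Implicit Arguments.
Unset Strict Implicit.
Unset Printing Implicit Defensive.

Import Order.TTheory GRing.Theory Num.Theory.
Local Open Scope ring_scope.

Notation "A *t B" := (tensmx A B)
  (at level 40, left associativity, format "A  *t  B") : ring_scope.

(* Every edge is listed exactly once, as the pair (lower endpoint, higher
   endpoint); the order in which edges are listed is arbitrary. *)
Definition enumerates_edges (N E : nat) (g : rel 'I_N)
    (ed : 'I_E -> 'I_N * 'I_N) : Prop :=
  injective ed /\
  codom ed =i [pred p : 'I_N * 'I_N | (p.1 < p.2)%N && g p.1 p.2].

Definition connected_graph (N : nat) (g : rel 'I_N) : Prop :=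
  forall i j : 'I_N, connect g i j.

Definition incidence (R : realType) (N E : nat) (ed : 'I_E -> 'I_N * 'I_N) :
    'M[R]_(E, N) :=
  \matrix_(e, i) (if i == (ed e).1 then 1 else if i == (ed e).2 then -1 else 0).

(* Both identities are required, and the two dimensions are kept separate,
   because [V_2, 1/sqrt N 1_N] has N.-1 + 1 columns, a number equal but not
   convertible to N. *)
Definition orthogonal_mx (R : realType) (m n : nat) (A : 'M[R]_(m, n)) : Prop :=
  A^T *m A = 1%:M /\ A *m A^T = 1%:M.

Definition normalized_ones (R : realType) (N : nat) : 'cV[R]_N :=
  const_mx (Num.sqrt N%:R)^-1.

Definition Smx (R : realType) (E n : nat) (s : 'rV[R]_n) : 'M[R]_(E, n + 1) :=
  row_mx (\matrix_(i < E, j < n) (s 0 j *+ (i == j :> nat))) 0.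

(* C = U S V^T is a singular value decomposition in which the zero singular
   value occupies the last column of V, normalized to 1_N / sqrt N. The nonzero
   singular values need not be ordered. *)
Definition is_svd (R : realType) (N E : nat) (C : 'M[R]_(E, N)) (U : 'M[R]_E)
    (V2 : 'M[R]_(N, N.-1)) (s : 'rV[R]_(N.-1)) : Prop :=
  let V := row_mx V2 (normalized_ones R N) in
  [/\ orthogonal_mx U, orthogonal_mx V, forall j, 0 < s 0 j
    & C = U *m Smx E s *m V^T].

Definition posdef (R : realType) (n : nat) (A : 'M[R]_n) : Prop :=
  A^T = A /\ forall x : 'cV[R]_n, x != 0 -> 0 < (x^T *m A *m x) 0 0.

Definition possemidef (R : realType) (n : nat) (A : 'M[R]_n) : Prop :=
  A^T = A /\ forall x : 'cV[R]_n, 0 <= (x^T *m A *m x) 0 0.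

Lemma sum_const_ord (N M : nat) : (\sum_(k < N) M = N * M)%N.
Proof. by rewrite sum_nat_const card_ord. Qed.

Definition blockdiag (R : realType) (N M : nat) (Ru : 'I_N -> 'M[R]_M) :
    'M[R]_(N * M) :=
  castmx (sum_const_ord N M, sum_const_ord N M) (\mxdiag_(k < N) Ru k).

(* 1_N / sqrt N ⊗ I_M, whose 1 * M columns are cast to M. *)
Definition calV0 (R : realType) (N M : nat) : 'M[R]_(N * M, M) :=
  castmx (erefl, mul1n M) (normalized_ones R N *t (1%:M : 'M[R]_M)).

Definition Rmx (R : realType) (N M : nat) (V2 : 'M[R]_(N, N.-1))
    (s : 'rV[R]_(N.-1)) (Ru : 'I_N -> 'M[R]_M) (eta : R) :
    'M[R]_(N.-1 * M + M + N.-1 * M) :=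
  let H := blockdiag Ru in
  let cS2 := diag_mx s *t (1%:M : 'M[R]_M) in
  let cV2 := V2 *t (1%:M : 'M[R]_M) in
  let cV0 := calV0 R N M in
  block_mx
    (block_mx (cV2^T *m H *m cV2 + eta *: (cS2^T *m cS2)) (cV2^T *m H *m cV0)
              (cV0^T *m H *m cV2) (N%:R^-1 *: \sum_k Ru k))
    (col_mx cS2^T 0)
    (row_mx (- cS2) 0)
    0.

Definition Bmx (R : realType) (N M : nat) (V2 : 'M[R]_(N, N.-1))
    (s : 'rV[R]_(N.-1)) (Ru : 'I_N -> 'M[R]_M) (eta mu : R) :
    'M[R]_(N.-1 * M + M + N.-1 * M) :=
  1%:M - mu *: Rmx V2 s Ru eta.

(* The eigenvalues of a real matrix are taken in the complex numbers R[i].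
   The set is finite, and nonempty unless n = 0, in which case the value is
   sup set0 = 0. *)
Definition spectral_radius (R : realType) (n : nat) (A : 'M[R]_n) : R :=
  sup [set r : R | exists z : R[i],
    eigenvalue (map_mx (real_complex R) A) z /\ r = ComplexField.Normc.normc z]%classic.

(* Main.v *)
(* The matrix R' has the saddle-point form [K, T; -T^T, 0]. For every eta > 0
   the block K is positive definite: with w = V_2 x + V_0 y,
     <K (x, y), (x, y)> = <H w, w> + eta |S_2 x|^2,
   where H >= 0 and S_2 is invertible, while for x = 0 the form is
   <(sum_k R_{u,k}) y, y> / N. If a + i b is a left eigenvector of R' whose
   eigenvalue has real part <= 0, then the K-components of a and b vanish, and
   injectivity of T kills the remaining ones. Hence the spectrum of R' lies in
   the open right half-plane, so |1 - mu z| < 1 for all eigenvalues z once mu is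
   small, and one can take etabar = 0. *)

Require Import Defs.
From HB Require Import structures.
From mathcomp Require Import all_boot all_order all_algebra.
From mathcomp Require Import complex mxtens.
From mathcomp Require Import boolp classical_sets reals.
From mathcomp Require Import ring lra.

Set Implicit Arguments.
Unset Strict Implicit.
Unset Printing Implicit Defensive.

Import Order.TTheory GRing.Theory Num.Theory.
Local Open Scope ring_scope.

(** * Eigenvalues of real saddle-point matrices *)

(** Row vectors match the left eigenvectors of [eigenvalue]; the trace reads off the 1 x 1 product
    and is invariant under transposition. *)
Definition qform (R : realType) (n : nat) (A : 'M[R]_n) (u : 'rV[R]_n) : R :=
  \tr (u *m A *m u^T).

Lemma eigenvalue_Re_Im (R : realType) (n : nat) (A : 'M[R]_n) (z : R[i]) :
  eigenvalue (map_mx (real_complex R) A) z ->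
  exists a b : 'rV[R]_n,
    [/\ a *m A = complex.Re z *: a - complex.Im z *: b,
        b *m A = complex.Im z *: a + complex.Re z *: b &
        (a != 0) || (b != 0)].
Proof.
have ReD : {morph @complex.Re R : x y / x + y} by move=> [? ?] [? ?].
have ImD : {morph @complex.Im R : x y / x + y} by move=> [? ?] [? ?].
move=> /eigenvalueP [v vA v0].
exists (map_mx (@complex.Re R) v), (map_mx (@complex.Im R) v); split.
- apply/rowP => j; have /rowP/(_ j) := vA.
  rewrite !mxE => /(congr1 (@complex.Re R)).
  rewrite (big_morph _ ReD (erefl _)).
  case: z (v 0 j) {vA} => [p q] [x y] /= <-.
  by apply: eq_bigr => k _; rewrite !mxE; case: (v 0 k) => ? ? /=; ring.
- apply/rowP => j; have /rowP/(_ j) := vA.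
  rewrite !mxE => /(congr1 (@complex.Im R)).
  rewrite (big_morph _ ImD (erefl _)); case: z (v 0 j) {vA} => [p q] [x y] /=.
  rewrite [RHS]addrC => <-.
  by apply: eq_bigr => k _; rewrite !mxE; case: (v 0 k) => ? ? /=; ring.
- rewrite -negb_and; apply: contra v0 => /andP[/eqP/rowP a0 /eqP/rowP b0].
  apply/eqP/rowP => j; have := a0 j; have := b0 j; rewrite !mxE.
  by case: (v 0 j) => x y /= -> ->.
Qed.

Lemma mulmx_tr_ge0 (R : realType) (n : nat) (u : 'rV[R]_n) :
  0 <= \tr (u *m u^T).
Proof.
by rewrite trace_mx11 mxE sumr_ge0// => i _; rewrite mxE -expr2 sqr_ge0.
Qed.

(** The cross terms u T w^T and w T^T u^T are transposes of each other and enter with opposite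
    signs, so their traces cancel. *)
Lemma qform_saddle (R : realType) (n m : nat) (K : 'M[R]_n) (T : 'M[R]_(n, m))
    (u : 'rV[R]_n) (w : 'rV[R]_m) :
  qform (block_mx K T (- T^T) 0) (row_mx u w) = qform K u.
Proof.
rewrite /qform mul_row_block tr_row_mx mul_row_col mulmx0 addr0 mulmxDl mulmxN.
rewrite mulNmx !mxtraceD raddfN /= -[X in _ - X + _]mxtrace_tr.
by rewrite !trmx_mul !trmxK mulmxA subrK.
Qed.

(* For a unit left eigenvector [a + i b] the real part of the eigenvalue is
   [qform A a + qform A b], which only sees the symmetric part of [A]: the
   coupling blocks cancel. *)
Lemma saddle_eigenvalue_Re_gt0 (R : realType) (n m : nat) (K : 'M[R]_n)
    (T : 'M[R]_(n, m)) (z : R[i]) :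
  (forall u, u != 0 -> 0 < qform K u) ->
  (forall w : 'rV_m, w *m T^T = 0 -> w = 0) ->
  eigenvalue (map_mx (real_complex R) (block_mx K T (- T^T) 0)) z ->
  0 < complex.Re z.
Proof.
set A := block_mx _ _ _ _ => Kpos Tinj /eigenvalue_Re_Im [a [b [aA bA ab0]]].
case: z aA bA => p q /= aA bA.
have Kge0 u : 0 <= qform K u.
  have [->|/Kpos/ltW//] := eqVneq u 0.
  by rewrite /qform !mul0mx raddf0.
have K_eq0 u : qform K u = 0 -> u = 0.
  by move=> Ku; apply/eqP; apply: contra_eqT Ku => /Kpos/lt0r_neq0.
(* With z = p + i q, the mixed terms -q <b, a> and q <a, b> cancel. *)
have sum_qform : qform A a + qform A b =
    p * (\tr (a *m a^T) + \tr (b *m b^T)).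
  rewrite /qform aA bA !mulmxDl mulNmx -!scalemxAl.
  rewrite !mxtraceD raddfN /= !mxtraceZ.
  by rewrite -[\tr (b *m a^T)]mxtrace_tr trmx_mul trmxK; ring.
rewrite ltNge; apply/negP => p_le0.
have sum_le0 : qform K (lsubmx a) + qform K (lsubmx b) <= 0.
  rewrite -(qform_saddle K T _ (rsubmx a)) -(qform_saddle K T _ (rsubmx b)).
  by rewrite !hsubmxK sum_qform mulr_le0_ge0 // addr_ge0 ?mulmx_tr_ge0.
have la0 : lsubmx a = 0.
  by apply: K_eq0; have := Kge0 (lsubmx a); have := Kge0 (lsubmx b); lra.
have lb0 : lsubmx b = 0.
  by apply: K_eq0; have := Kge0 (lsubmx a); have := Kge0 (lsubmx b); lra.
(* Once [lsubmx c] vanishes, the left part of [c *m A] is [- rsubmx c *m T^T]. Here [d] stands for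
   the right side of an eigenvector equation, a combination of [a] and [b], so its left part is 0
   too. *)
have kill (c d : 'rV_(n + m)) : c *m A = d -> lsubmx c = 0 ->
    lsubmx d = 0 -> c = 0.
  rewrite -{1 3}(hsubmxK c) => /(congr1 lsubmx) + c0 d0.
  rewrite c0 d0 mul_row_block row_mxKl mul0mx add0r mulmxN.
  by move/eqP; rewrite oppr_eq0 => /eqP/Tinj ->; rewrite row_mx0.
have a0 : a = 0.
  apply: (kill _ _ aA la0).
  by rewrite raddfB /= !linearZ /= la0 lb0 !(scaler0, oppr0, addr0).
have b0 : b = 0.
  apply: (kill _ _ bA lb0).
  by rewrite raddfD /= !linearZ /= la0 lb0 !scaler0 addr0.
by rewrite a0 b0 eqxx in ab0.
Qed.

(** * Small step-sizes and the spectral radius *)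

Lemma normc_1Bscale_lt1 (R : realType) (z : R[i]) : 0 < complex.Re z ->
  exists mubar : R, 0 < mubar /\ forall mu, 0 < mu -> mu < mubar ->
    ComplexField.Normc.normc (1 - (mu%:C)%C * z) < 1.
Proof.
case: z => p q /= p0.
have d0 : 0 < p ^+ 2 + q ^+ 2 by rewrite ltr_pwDl ?exprn_gt0 ?sqr_ge0.
(* Since |1 - mu z|^2 = 1 - mu (2 p - mu |z|^2), the threshold is 2 p / |z|^2. *)
exists (2 * p / (p ^+ 2 + q ^+ 2)); split => [|mu mu0].
  by rewrite divr_gt0 // mulr_gt0.
rewrite ltr_pdivlMr // => mu_lt.
rewrite /= -[ltRHS]sqrtr1 ltr_sqrt // !mul0r subr0 addr0 sub0r.
rewrite -subr_gt0.
have -> : 1 - ((1 - mu * p) ^+ 2 + (- (mu * q)) ^+ 2) =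
  mu * (2 * p - mu * (p ^+ 2 + q ^+ 2)) by ring.
by rewrite mulr_gt0 // subr_gt0.
Qed.

(** A common bound r < 1, rather than one strict inequality per element, survives passing to a
    supremum. *)
Lemma normc_1Bscale_seq (R : realType) (rs : seq R[i]) :
  (forall z, z \in rs -> 0 < complex.Re z) ->
  exists mubar : R, 0 < mubar /\ forall mu, 0 < mu -> mu < mubar ->
    exists2 r : R, 0 <= r < 1 & forall z, z \in rs ->
    ComplexField.Normc.normc (1 - (mu%:C)%C * z) <= r.
Proof.
elim: rs => [_|z rs IH rs_pos].
  by exists 1; split => // mu _ _; exists 0; rewrite ?lexx ?ltr01.
have [|m1 [m1_gt0 IH1]] := IH.
  by move=> y yrs; apply: rs_pos; rewrite inE yrs orbT.
have [|m2 [m2_gt0 z1]] := @normc_1Bscale_lt1 R z.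
  by apply: rs_pos; rewrite mem_head.
exists (Num.min m1 m2); split => [|mu mu0]; first by rewrite lt_min m1_gt0.
rewrite lt_min => /andP[mu1 mu2].
have [r /andP[r0 r1] rsr] := IH1 _ mu0 mu1.
exists (Num.max r (ComplexField.Normc.normc (1 - (mu%:C)%C * z))).
  by rewrite le_max r0 /= gt_max r1 z1.
move=> y; rewrite inE le_max => /orP[/eqP->|/rsr->//].
by rewrite lexx orbT.
Qed.

Lemma spectral_radius_1Bscale_lt1 (R : realType) (n : nat) (A : 'M[R]_n) :
  (forall z, eigenvalue (map_mx (real_complex R) A) z -> 0 < complex.Re z) ->
  exists mubar : R, 0 < mubar /\ forall mu, 0 < mu -> mu < mubar ->
    spectral_radius (1%:M - mu *: A) < 1.
Proof.
move=> A_pos; set AC := map_mx _ A in A_pos.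
(* [R[i]] is algebraically closed, so the eigenvalues are the roots in a finite list splitting the
   characteristic polynomial. *)
have [rs char_rs] := closed_field_poly_normal (char_poly AC).
have mem_rs z : (z \in rs) = eigenvalue AC z.
  rewrite eigenvalue_root_char char_rs (monicP (char_poly_monic _)) scale1r.
  by rewrite root_prod_XsubC.
have [|mubar [mubar0 H]] := @normc_1Bscale_seq R rs.
  by move=> z; rewrite mem_rs; exact: A_pos.
exists mubar; split => // mu mu0 /(H _ mu0) [r /andP[r0 r1] rsr].
rewrite /spectral_radius; set S := [set _ | _]%classic.
have [S0|/set0P S0] := eqVneq S set0; first by rewrite S0 sup0 ltr01.
apply: le_lt_trans r1; apply: ge_sup => // _ [z [/eigenvalueP[v vB v0] ->]].
have muC : (mu%:C)%C != 0 by rewrite eq_complex /= negb_and gt_eqF.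
(* An eigenvalue z of 1 - mu A comes from the eigenvalue (1 - z) / mu of A, with the same
   eigenvector. *)
have zE : z = 1 - (mu%:C)%C * ((1 - z) / (mu%:C)%C).
  by rewrite mulrCA mulfV // mulr1 opprB addrCA subrr addr0.
rewrite zE; apply: rsr; rewrite mem_rs; apply/eigenvalueP; exists v => //.
move: vB; rewrite map_mxB map_mxZ map_mx1 mulmxBr mulmx1 -scalemxAr => vB.
apply: (scalerI muC); rewrite scalerA mulrCA mulfV // mulr1 scalerBl scale1r.
by rewrite -vB opprB addrCA subrr addr0.
Qed.

(** * Block-diagonal matrices and Kronecker indexing *)

(** Kronecker products and block matrices both put the pair (k, a) at position k * M + a. *)
Lemma cast_ord_mxtens_index (N M : nat) (k : 'I_N) (a : 'I_M) :
  cast_ord (esym (sum_const_ord N M)) (mxtens_index (k, a)) = tagnat.Rank k a.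
Proof.
apply: val_inj; transitivity (k * M + a)%N => //; rewrite [RHS]tagnat.RankEsum.
by rewrite (big_ord_narrow (ltnW (ltn_ord k))) sum_const_ord.
Qed.

Lemma blockdiagE (R : realType) (N M : nat) (Ru : 'I_N -> 'M[R]_M)
    (k l : 'I_N) (a b : 'I_M) :
  blockdiag Ru (mxtens_index (k, a)) (mxtens_index (l, b)) =
  Ru k a b *+ (k == l).
Proof.
rewrite castmxE !cast_ord_mxtens_index.
(* [\mxdiag] is a block matrix whose diagonal blocks pass through [conform_mx], the identity on
   matching dimensions. *)
have := @mxblockK _ _ _ (fun=> M) (fun=> M)
  (fun i j => if i == j then conform_mx 0 (Ru i) else 0) k l.
move=> /matrixP/(_ a b); rewrite mxE => ->.
by case: eqP => _; rewrite ?conform_mx_id ?mxE ?mulr1n.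
Qed.

Lemma sum_mxtens_index (V : nmodType) (m n : nat) (F : 'I_(m * n) -> V) :
  \sum_i F i = \sum_(k < m) \sum_(a < n) F (mxtens_index (k, a)).
Proof.
rewrite pair_big (reindex (@mxtens_index m n)) /=.
  by apply: eq_bigr => -[].
exists (@mxtens_unindex _ _) => i _; last exact: mxtens_unindexK.
exact: mxtens_indexK.
Qed.

Definition tens_row (R : realType) (N M : nat) (w : 'rV[R]_(N * M))
    (k : 'I_N) : 'rV[R]_M :=
  \row_a w 0 (mxtens_index (k, a)).

Lemma qform_blockdiag (R : realType) (N M : nat) (Ru : 'I_N -> 'M[R]_M)
    (w : 'rV[R]_(N * M)) :
  qform (blockdiag Ru) w = \sum_k qform (Ru k) (tens_row w k).
Proof.
rewrite /qform trace_mx11 mxE sum_mxtens_index; apply: eq_bigr => l _.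
rewrite trace_mx11 mxE; apply: eq_bigr => b _.
rewrite !mxE sum_mxtens_index (bigD1 l) //= [X in _ + X]big1 ?addr0.
  congr (_ * _); apply: eq_bigr => a _.
  by rewrite blockdiagE eqxx mxE.
by move=> k /negPf kl; apply: big1 => a _; rewrite blockdiagE kl mulr0.
Qed.

Lemma tens_row_mulV0 (R : realType) (N M : nat) (y : 'rV[R]_M) (k : 'I_N) :
  tens_row (y *m (calV0 R N M)^T) k = (Num.sqrt N%:R)^-1 *: y.
Proof.
apply/rowP => a; rewrite !mxE (bigD1 a) //= [X in _ + X]big1 => [|b ba].
  rewrite addr0 mxE castmxE /= mulrC.
  have -> : cast_ord (esym (mul1n M)) a = mxtens_index (0, a) by apply: val_inj.
  by rewrite cast_ord_id tensmxE !mxE eqxx mulr1.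
rewrite mxE castmxE /=.
have -> : cast_ord (esym (mul1n M)) b = mxtens_index (0, b) by apply: val_inj.
by rewrite cast_ord_id tensmxE !mxE eq_sym (negPf ba) !mulr0.
Qed.

Lemma tensmx11 (R : realType) (m n : nat) :
  (1%:M : 'M[R]_m) *t (1%:M : 'M[R]_n) = 1%:M.
Proof.
apply/matrixP => i j.
case: (mxtens_indexP i) => k a; case: (mxtens_indexP j) => l b.
rewrite tensmxE !mxE (can_eq (@mxtens_indexK m n)) xpair_eqE -natrM.
by rewrite mulnb.
Qed.

(** Right multiplication by diag(1 / s_j) ⊗ I_M undoes the product. This serves both the positivity
    of |S_2 x|^2 and the injectivity of the coupling block. *)
Lemma mulmx_diag_tens_inj (R : realType) (n M : nat) (s : 'rV[R]_n)
    (w : 'rV[R]_(n * M)) :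
  (forall j, 0 < s 0 j) ->
  w *m (diag_mx s *t (1%:M : 'M[R]_M)) = 0 -> w = 0.
Proof.
move=> s0 /(congr1 (mulmxr (diag_mx (\row_j (s 0 j)^-1) *t (1%:M : 'M_M)))) /=.
rewrite mul0mx -mulmxA tensmx_mul mulmx_diag mul1mx.
have -> : \row_j (s 0 j * (\row_j (s 0 j)^-1) 0 j) = const_mx 1 :> 'rV[R]_n.
  by apply/rowP => j; rewrite !mxE mulfV // gt_eqF.
by rewrite diag_const_mx tensmx11 mulmx1.
Qed.

(** * Positivity of the primal block *)

Lemma mulmx_tr_gt0 (R : realType) (n : nat) (u : 'rV[R]_n) :
  u != 0 -> 0 < \tr (u *m u^T).
Proof.
move=> u0; rewrite lt_neqAle mulmx_tr_ge0 andbT eq_sym.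
apply: contra u0 => /eqP; rewrite trace_mx11 mxE => /psumr_eq0P H.
apply/eqP/rowP => i; rewrite mxE; apply/eqP.
have := H (fun j _ => _) i isT; rewrite !mxE => /(_ _)/eqP.
by rewrite mulf_eq0 orbb; apply => j; rewrite mxE -expr2 sqr_ge0.
Qed.

(** The block matrix is [V W]^T H [V W]. *)
Lemma qform_gram (R : realType) (n m p : nat) (H : 'M[R]_p) (V : 'M[R]_(p, n))
    (W : 'M[R]_(p, m)) (x : 'rV[R]_n) (y : 'rV[R]_m) :
  qform (block_mx (V^T *m H *m V) (V^T *m H *m W)
                  (W^T *m H *m V) (W^T *m H *m W)) (row_mx x y) =
  qform H (x *m V^T + y *m W^T).
Proof.
rewrite /qform mul_row_block tr_row_mx mul_row_col [(_ + _)^T]linearD /=.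
by rewrite !trmx_mul !trmxK !mulmxDl !mulmxDr !mulmxA addrACA.
Qed.

Lemma qform_blockdiag_ge0 (R : realType) (N M : nat) (Ru : 'I_N -> 'M[R]_M)
    (w : 'rV[R]_(N * M)) :
  (forall k, possemidef (Ru k)) -> 0 <= qform (blockdiag Ru) w.
Proof.
move=> hRu; rewrite qform_blockdiag sumr_ge0 // => k _.
by have [_ /(_ (tens_row w k)^T)] := hRu k; rewrite trmxK -trace_mx11.
Qed.

(** Two factors 1 / sqrt N give 1 / N: the averaged covariance in the corner of R' acts as V_0^T H
    V_0. *)
Lemma qform_blockdiag_mulV0 (R : realType) (N M : nat) (Ru : 'I_N -> 'M[R]_M)
    (y : 'rV[R]_M) :
  qform (blockdiag Ru) (y *m (calV0 R N M)^T) =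
  qform (N%:R^-1 *: \sum_k Ru k) y.
Proof.
rewrite qform_blockdiag /qform -scalemxAr -scalemxAl mxtraceZ mulmx_sumr.
rewrite mulmx_suml raddf_sum mulr_sumr; apply: eq_bigr => k _ /=.
rewrite tens_row_mulV0 linearZ /= -!scalemxAl -scalemxAr !mxtraceZ mulrA.
by rewrite -expr2 exprVn sqr_sqrtr // ler0n.
Qed.

(** The block K of the saddle-point form, spelled as inside [Rmx] so that the two are
    convertible. *)
Definition primal_block (R : realType) (N M : nat) (V2 : 'M[R]_(N, N.-1))
    (s : 'rV[R]_(N.-1)) (Ru : 'I_N -> 'M[R]_M) (eta : R) :
    'M[R]_(N.-1 * M + M) :=
  let H := blockdiag Ru in
  let cS2 := diag_mx s *t (1%:M : 'M[R]_M) in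
  let cV2 := V2 *t (1%:M : 'M[R]_M) in
  let cV0 := calV0 R N M in
  block_mx (cV2^T *m H *m cV2 + eta *: (cS2^T *m cS2)) (cV2^T *m H *m cV0)
           (cV0^T *m H *m cV2) (N%:R^-1 *: \sum_k Ru k).

Lemma qform_primal_block (R : realType) (N M : nat) (V2 : 'M[R]_(N, N.-1))
    (s : 'rV[R]_(N.-1)) (Ru : 'I_N -> 'M[R]_M) (eta : R)
    (x : 'rV[R]_(N.-1 * M)) (y : 'rV[R]_M) :
  let cS2 := diag_mx s *t (1%:M : 'M[R]_M) in
  let cV2 := V2 *t (1%:M : 'M[R]_M) in
  qform (primal_block V2 s Ru eta) (row_mx x y) =
  qform (blockdiag Ru) (x *m cV2^T + y *m (calV0 R N M)^T) +
  eta * \tr ((x *m cS2^T) *m (x *m cS2^T)^T).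
Proof.
move=> cS2 cV2; rewrite -qform_gram /primal_block.
rewrite /qform !mul_row_block !tr_row_mx !mul_row_col.
(* Turns the V_0^T H V_0 term of the Gram side into the averaged covariance, so that both sides
   expand into the same traces. *)
have := qform_blockdiag_mulV0 Ru y; rewrite /qform.
rewrite !(trmx_mul, trmxK) !mulmxDr !mulmxDl.
rewrite -/cS2 -/cV2; move: (blockdiag Ru) => H.
rewrite -[x *m (_ *: _)]scalemxAr -[(eta *: _) *m x^T]scalemxAl.
rewrite !mxtraceD mxtraceZ !mulmxA => ->.
by ring.
Qed.

Lemma primal_block_posdef (R : realType) (N M : nat) (V2 : 'M[R]_(N, N.-1))
    (s : 'rV[R]_(N.-1)) (Ru : 'I_N -> 'M[R]_M) (eta : R)
    (u : 'rV[R]_(N.-1 * M + M)) :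
  (0 < N)%N -> (forall j, 0 < s 0 j) -> 0 < eta ->
  (forall k, possemidef (Ru k)) -> posdef (\sum_k Ru k) -> u != 0 ->
  0 < qform (primal_block V2 s Ru eta) u.
Proof.
move=> N_gt0 s_gt0 eta_gt0 hRu hsum; rewrite -(hsubmxK u).
set x := lsubmx u; set y := rsubmx u => u0.
rewrite qform_primal_block.
have [x0|x_neq0] := eqVneq x 0; last first.
  apply: ltr_wpDl; first exact: qform_blockdiag_ge0.
  rewrite mulr_gt0 // mulmx_tr_gt0 //; apply: contra x_neq0 => /eqP.
  by rewrite trmx_tens tr_diag_mx trmx1 => /mulmx_diag_tens_inj ->.
rewrite x0 !mul0mx add0r mxtrace0 mulr0 addr0 qform_blockdiag_mulV0.
rewrite /qform -scalemxAr -scalemxAl mxtraceZ mulr_gt0 //.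
  by rewrite invr_gt0 ltr0n.
have [_ /(_ y^T)] := hsum; rewrite trmxK -trace_mx11; apply.
by apply: contra u0; rewrite trmx_eq0 x0 => /eqP ->; rewrite row_mx0.
Qed.
Theorem theorem2 (R : realType) (N M E : nat) (hN : (0 < N)%N)
  (g : rel 'I_N) (g_sym : symmetric g) (g_irr : irreflexive g)
  (g_conn : connected_graph g)
  (ed : 'I_E -> 'I_N * 'I_N) (hed : enumerates_edges g ed)
  (U : 'M[R]_E) (V2 : 'M[R]_(N, N.-1)) (s : 'rV[R]_(N.-1))
  (hsvd : is_svd (incidence R ed) U V2 s)
  (Ru : 'I_N -> 'M[R]_M)
  (hRu : forall k : 'I_N, possemidef (Ru k))
  (hsum : posdef (\sum_(k < N) Ru k)) :
  exists etabar : R, forall eta : R, 0 <= eta -> etabar < eta ->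
    exists mubar : R, 0 < mubar /\
      forall mu : R, 0 < mu -> mu < mubar ->
        spectral_radius (Bmx V2 s Ru eta mu) < 1.
Proof.
have [_ _ s_gt0 _] := hsvd.
exists 0 => eta _ eta_gt0; apply: spectral_radius_1Bscale_lt1 => z.
rewrite /Rmx; set cS2 := diag_mx s *t _.
(* Exhibits the lower-left block as -T^T with T = [col_mx cS2^T 0]. *)
have -> : row_mx (- cS2) 0 = - (col_mx cS2^T 0)^T :> 'M_(_, _ + M).
  by rewrite tr_col_mx trmxK trmx0 opp_row_mx oppr0.
apply: saddle_eigenvalue_Re_gt0 => [u|w].
  exact: (@primal_block_posdef _ _ _ V2).
(* As T^T = [S_2 ⊗ I_M, 0], its left part already determines w. *)
rewrite tr_col_mx trmxK mul_mx_row => /(congr1 lsubmx).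
by rewrite row_mxKl linear0; exact: mulmx_diag_tens_inj.
Qed.
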